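(* Let $D$ be an integral domain and $\star$ a semistar operation on $D$. Suppose that $D$ is a P$\star$MD with $\widetilde{\star}\text{-}\dim(D)=n$. Then $\star[X]\text{-}\dim(D[X])=n+1$.
   Context: For a domain $D$ with quotient field $K$, $\overline{\mathcal F}(D)$ is the set of nonzero $D$-submodules of $K$ and $f(D)$ the set of nonzero finitely generated $D$-submodules of $K$. A semistar operation on $D$ is a map $\star:\overline{\mathcal F}(D)\to\overline{\mathcal F}(D)$, $E\mapsto E^\star$, such that for all $0\ne x\in K$ and $E,F\in\overline{\mathcal F}(D)$: $(xE)^\star=xE^\star$; $E\subseteq F$ implies $E^\star\subseteq F^\star$; $E\subseteq E^\star=(E^\star)^\star$. Define $E^{\star_f}:=\bigcup\{F^\star\mid F\in f(D),F\subseteq E\}$. A nonzero ideal $I$ of $D$ is a quasi-$\star$-ideal if $I^\star\cap D=I$; a quasi-$\star$-prime is a prime quasi-$\star$-ideal; $\operatorname{QMax}^{\star}(D)$ is the set of maximal elements of the set of proper quasi-$\star$-ideals (they are prime). $\widetilde\star$ is the semistar operation $E^{\widetilde\star}:=\bigcap\{ED_P\mid P\in\operatorname{QMax}^{\star_f}(D)\}$ (equal to $K$ if $\operatorname{QMax}^{\star_f}(D)=\emptyset$). $D$ is a P$\star$MD (Prüfer $\star$-multiplication domain) if $(II^{-1})^{\star_f}=D^\star$ for every $I\in f(D)$, where $I^{-1}=\{x\in K\mid xI\subseteq D\}$. $\star\text{-}\dim(D)$ is the supremum of the integers $n$ such that there is a chain $(0)\subsetneq P_1\subsetneq\cdots\subsetneq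 P_n$ with each $P_i$ a quasi-$\star$-prime of $D$; it is $0$ if there are no quasi-$\star$-primes. Let $X,Y$ be indeterminates, $D_1:=D[X]$, $K_1:=K(X)$, $\Theta_1^{\star}:=\{Q\in\operatorname{Spec}(D_1)\mid Q\cap D=(0)\text{ or }(Q\cap D)^{\star_f}\subsetneq D^{\star}\}$, $\mathfrak S_1^\star:=D_1[Y]\setminus\bigcup\{Q[Y]\mid Q\in\Theta_1^\star\}$. The semistar operation $\star[X]$ on $D[X]$ is defined by $E^{\star[X]}:=E[Y]_{\mathfrak S_1^\star}\cap K_1$ for $E\in\overline{\mathcal F}(D_1)$. *)

(* Defs.v *)
From HB Require Import structures.
From mathcomp Require Import all_boot all_order all_algebra.
From mathcomp Require Import classical_sets.

Set Implicit Arguments.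
Unset Strict Implicit.
Unset Printing Implicit Defensive.

Import GRing.Theory.
Local Open Scope ring_scope.
Local Open Scope classical_set_scope.

Local Notation tofrac := (@FracField.tofrac _).
Local Notation "x %:F" := (tofrac x).

Definition domain_in (D : idomainType) : set {fraction D} :=
  [set d%:F | d in [set: D]].

Arguments domain_in D : clear implicits.

Definition ideal_in (D : idomainType) (I : set D) : set {fraction D} :=
  [set d%:F | d in I].

Record nz_submodule (D : idomainType) (E : set {fraction D}) : Prop := {
  nz_submodule0 : E 0;
  nz_submoduleD : forall x y, E x -> E y -> E (x + y);
  nz_submoduleM : forall (d : D) x, E x -> E (d%:F * x);
  nz_submodule_neq0 : exists2 x, E x & x != 0 }.

Definition span (D : idomainType) (n : nat) (g : 'I_n -> {fraction D}) :
    set {fraction D} :=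
  [set \sum_(i < n) (c i)%:F * g i | c in [set: 'I_n -> D]].

Definition nz_fg_submodule (D : idomainType) (F : set {fraction D}) : Prop :=
  nz_submodule F /\ exists (n : nat) (g : 'I_n -> {fraction D}), F = span g.

Definition submodule_mul (D : idomainType) (E F : set {fraction D}) :
    set {fraction D} :=
  [set x | exists (n : nat) (a b : 'I_n -> {fraction D}),
     [/\ forall i, E (a i), forall i, F (b i) & x = \sum_(i < n) a i * b i]].

Definition submodule_inv (D : idomainType) (I : set {fraction D}) :
    set {fraction D} :=
  [set x | [set x * y | y in I] `<=` domain_in D].

(* Operations are total functions on sets; only their values on nonzero
   submodules are constrained. *)
Record semistar (D : idomainType)
    (star : set {fraction D} -> set {fraction D}) : Prop := {
  semistar_submodule : forall E, nz_submodule E -> nz_submodule (star E);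
  semistar_scale : forall (x : {fraction D}) E, x != 0 -> nz_submodule E ->
    star [set x * y | y in E] = [set x * y | y in star E];
  semistar_mono : forall E F, nz_submodule E -> nz_submodule F ->
    E `<=` F -> star E `<=` star F;
  semistar_ext : forall E, nz_submodule E -> E `<=` star E;
  semistar_idem : forall E, nz_submodule E -> star (star E) = star E }.

Definition star_f (D : idomainType)
    (star : set {fraction D} -> set {fraction D}) (E : set {fraction D}) :
    set {fraction D} :=
  \bigcup_(F in [set F | nz_fg_submodule F /\ F `<=` E]) star F.

(* Not necessarily proper ideals of [D], i.e. the submodules of the regular
   module; [idealr_closed] below requires in addition that [1] is not in the
   ideal. *)
Definition ideal (D : idomainType) (I : set D) : Prop :=
  GRing.submod_closed (mem I : {pred D^o}).

Definition prime_ideal (D : idomainType) (P : set D) : Prop :=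
  idealr_closed (mem P) /\ prime_idealr_closed (mem P).

Definition quasi_star_ideal (D : idomainType)
    (star : set {fraction D} -> set {fraction D}) (I : set D) : Prop :=
  [/\ ideal I, I <> [set 0] & [set d | star (ideal_in I) d%:F] = I].

Definition quasi_star_prime (D : idomainType)
    (star : set {fraction D} -> set {fraction D}) (P : set D) : Prop :=
  prime_ideal P /\ quasi_star_ideal star P.

Definition proper_quasi_star_ideal (D : idomainType)
    (star : set {fraction D} -> set {fraction D}) (I : set D) : Prop :=
  quasi_star_ideal star I /\ I <> setT.

Definition QMax (D : idomainType)
    (star : set {fraction D} -> set {fraction D}) : set (set D) :=
  [set M | proper_quasi_star_ideal star M /\
     forall I, proper_quasi_star_ideal star I -> M `<=` I -> I = M].

(* The localization [D_P], inside the quotient field. *)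
Definition local_ring (D : idomainType) (P : set D) : set {fraction D} :=
  [set x | exists a s : D, ~ P s /\ x = a%:F / s%:F].

(* An intersection over the empty family is the whole quotient field. *)
Definition star_tilde (D : idomainType)
    (star : set {fraction D} -> set {fraction D}) (E : set {fraction D}) :
    set {fraction D} :=
  \bigcap_(P in QMax (star_f star)) submodule_mul E (local_ring P).

Definition PstarMD (D : idomainType)
    (star : set {fraction D} -> set {fraction D}) : Prop :=
  forall I, nz_fg_submodule I ->
    star_f star (submodule_mul I (submodule_inv I)) = star (domain_in D).

(* [P 0, ..., P m] is a chain from the zero ideal with [m] proper inclusions,
   and [P 1, ..., P m] are quasi-star-primes. *)
Definition quasi_star_prime_chain (D : idomainType)
    (star : set {fraction D} -> set {fraction D}) (m : nat)
    (P : nat -> set D) : Prop :=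
  [/\ P 0%N = [set 0],
      forall i, (i < m)%N -> P i `<` P i.+1 &
      forall i, (i < m)%N -> quasi_star_prime star (P i.+1)].

(* [star]-dim [D] equals the natural number [n].  The trivial chain ([m = 0])
   always exists, so the dimension is [0] when there is no quasi-star-prime;
   if chains are unboundedly long, no [n] satisfies this. *)
Definition semistar_dim (D : idomainType)
    (star : set {fraction D} -> set {fraction D}) (n : nat) : Prop :=
  isLub [set m : nat | exists P, quasi_star_prime_chain star m P] n.

(* [A[Y]]: polynomials with all coefficients in [A]. *)
Definition poly_in (R : nzRingType) (A : set R) : set {poly R} :=
  [set p | forall i : nat, A p`_i].

Definition contraction (D : idomainType) (Q : set {poly D}) : set D :=
  [set d | Q d%:P].

Definition Theta1 (D : idomainType)
    (star : set {fraction D} -> set {fraction D}) : set (set {poly D}) :=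
  [set Q | prime_ideal Q /\
     (contraction Q = [set 0] \/
      star_f star (ideal_in (contraction Q)) `<` star (domain_in D))].

Definition S1 (D : idomainType)
    (star : set {fraction D} -> set {fraction D}) : set {poly {poly D}} :=
  ~` \bigcup_(Q in Theta1 star) poly_in Q.

(* [K(X)] is the fraction field of [D[X]], and [E[Y]_S] is formed in the
   field [K(X)(Y)], fractions of polynomials in [Y] over [K(X)]. *)
Definition star_X (D : idomainType)
    (star : set {fraction D} -> set {fraction D})
    (E : set {fraction {poly D}}) : set {fraction {poly D}} :=
  [set x | exists (f : {poly {fraction {poly D}}}) (s : {poly {poly D}}),
     [/\ poly_in E f, S1 star s &
         (x%:P)%:F = f%:F / (map_poly tofrac s)%:F]].

(* Main.v *)
(* Let T be the set of primes P of D with 1 not in P^{star_f}.  The nonzero members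
   of T are the quasi-star_tilde-primes of D, and the quasi-star[X]-primes of D[X]
   are the nonzero primes Q with Q :&: D in T.  A chain P_0 < ... < P_n in T
   gives the chain P_0[X] < ... < P_n[X] < (P_n, X).  Conversely, contract a
   chain of D[X] to D: two consecutive primes Q < Q' have the same contraction P
   only if Q = P[X] <> Q'.  Since D_P is a valuation domain for P in T, a prime
   contained in a prime extended from D is itself extended from D; hence at most
   one such coincidence occurs in a chain. *)
Require Import Defs.
From mathcomp Require Import all_boot all_order all_algebra.
From mathcomp Require Import classical_sets boolp zify.

Set Implicit Arguments.
Unset Strict Implicit.
Unset Printing Implicit Defensive.

(* [Defs] once more: [span] must not be that of [vector]. *)
Import Defs GRing.Theory.
Local Open Scope ring_scope.
Local Open Scope classical_set_scope.

Local Notation tofrac := (@FracField.tofrac _).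
Local Notation "x %:F" := (tofrac x).

(** * Ideals and prime ideals of a domain *)

Lemma idealE (D : idomainType) (I : set D) :
  ideal I <-> I 0 /\ forall a u v, I u -> I v -> I (a * u + v).
Proof.
split=> [[I0 IS]|[I0 IS]].
  split; first exact: set_mem I0.
  by move=> a u v Iu Iv; exact: set_mem (IS a u v (mem_set Iu) (mem_set Iv)).
split; first exact: mem_set.
by move=> a u v /set_mem Iu /set_mem Iv; apply: mem_set; exact: IS.
Qed.

Lemma ideal0 (D : idomainType) (I : set D) : ideal I -> I 0.
Proof. by case/idealE. Qed.

Lemma idealD (D : idomainType) (I : set D) u v :
  ideal I -> I u -> I v -> I (u + v).
Proof. by case/idealE=> _ IS Iu Iv; rewrite -[u]mul1r; exact: IS. Qed.

Lemma idealMl (D : idomainType) (I : set D) a u : ideal I -> I u -> I (a * u).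
Proof. by case/idealE=> I0 IS Iu; rewrite -[_ * _]addr0; exact: IS. Qed.

Lemma idealMr (D : idomainType) (I : set D) a u : ideal I -> I u -> I (u * a).
Proof. by move=> idI Iu; rewrite mulrC; exact: idealMl. Qed.

Lemma idealN (D : idomainType) (I : set D) u : ideal I -> I u -> I (- u).
Proof. by move=> idI Iu; rewrite -mulN1r; exact: idealMl. Qed.

Lemma idealB (D : idomainType) (I : set D) u v :
  ideal I -> I u -> I v -> I (u - v).
Proof. by move=> idI Iu Iv; apply: idealD => //; exact: idealN. Qed.

Lemma ideal_sum (D : idomainType) (I : set D) (J : finType) (P : pred J)
    (u : J -> D) :
  ideal I -> (forall j, P j -> I (u j)) -> I (\sum_(j | P j) u j).
Proof.
by move=> idI Iu; apply: big_ind => //; [exact: ideal0|move=> *; exact: idealD].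
Qed.

Lemma prime_idealE (D : idomainType) (P : set D) :
  prime_ideal P <->
  [/\ ideal P, ~ P 1 & forall u v, P (u * v) -> P u \/ P v].
Proof.
split=> [[[P0 /negP P1 PS] pP]|[/idealE [P0 PS] P1 pP]].
  split; last 2 first.
  - by move=> Q1; apply: P1; exact: mem_set.
  - move=> u v /mem_set /pP /orP [] /set_mem; by [left|right].
  apply/idealE; split; first exact: set_mem P0.
  by move=> a u v Iu Iv; exact: set_mem (PS a u v (mem_set Iu) (mem_set Iv)).
split.
  split; first exact: mem_set.
    by apply/negP => /set_mem.
  by move=> a u v /set_mem Iu /set_mem Iv; apply: mem_set; exact: PS.
by move=> u v /set_mem /pP [] /mem_set ->; rewrite ?orbT.
Qed.

Lemma prime_ideal_ideal (D : idomainType) (P : set D) :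
  prime_ideal P -> ideal P.
Proof. by case/prime_idealE. Qed.

Lemma prime_ideal_not1 (D : idomainType) (P : set D) :
  prime_ideal P -> ~ P 1.
Proof. by case/prime_idealE. Qed.

Lemma prime_idealM (D : idomainType) (P : set D) u v :
  prime_ideal P -> P (u * v) -> P u \/ P v.
Proof. by case/prime_idealE=> _ _; apply. Qed.

Lemma prime_idealX (D : idomainType) (P : set D) u k :
  prime_ideal P -> P (u ^+ k) -> P u.
Proof.
move=> pP; elim: k => [|k IHk]; first by move/(prime_ideal_not1 pP).
by rewrite exprS => /(prime_idealM pP) [].
Qed.

Lemma prime_ideal_prod (D : idomainType) (P : set D) (J : finType) (u : J -> D) :
  prime_ideal P -> P (\prod_j u j) -> exists j, P (u j).
Proof.
move=> pP; apply: contraPP => /forallNP nPu.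
by apply: (big_ind (fun x => ~ P x)) => [|u1 v1 nu nv|i _];
  [exact: prime_ideal_not1|case/(prime_idealM pP)|exact: nPu].
Qed.

Lemma ideal_neq0 (D : idomainType) (I : set D) :
  ideal I -> I <> [set 0] -> exists2 d, I d & d != 0.
Proof.
move=> idI In0; apply: contrapT => nI; apply: In0.
apply/seteqP; split=> [d Id|d ->]; last exact: ideal0.
by apply: contrapT => /eqP dn0; apply: nI; exists d.
Qed.

Lemma prime_ideal_set0 (D : idomainType) : prime_ideal [set (0 : D)].
Proof.
apply/prime_idealE; split.
- by apply/idealE; split=> // a u v -> ->; rewrite /= mulr0 addr0.
- by apply/eqP; rewrite oner_eq0.
- by move=> u v /eqP; rewrite mulf_eq0 => /orP [] /eqP ->; [left|right].
Qed.

(** * Submodules of the quotient field and finite spans *)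

Lemma nz_submodule_ideal (D : idomainType) (I : set D) :
  ideal I -> I <> [set 0] -> nz_submodule (ideal_in I).
Proof.
move=> idI /(ideal_neq0 idI) [d0 Id0 d0n0]; split.
- by exists 0; [exact: ideal0|rewrite tofrac0].
- by move=> _ _ [d Id <-] [e Ie <-]; exists (d + e);
    [exact: idealD|rewrite tofracD].
- by move=> a _ [d Id <-]; exists (a * d); [exact: idealMl|rewrite tofracM].
- by exists d0%:F; [exists d0|rewrite tofrac_eq0].
Qed.

Lemma nz_submodule_domain (D : idomainType) : nz_submodule (domain_in D).
Proof.
apply: nz_submodule_ideal => [|T0]; first by apply/idealE.
by have : [set: D] 1 by []; rewrite T0 => /eqP; rewrite oner_eq0.
Qed.

Lemma ideal_in_tofrac (D : idomainType) (I : set D) (d : D) :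
  ideal_in I d%:F <-> I d.
Proof.
split=> [[e Ie /eqP]|Id]; last by exists d.
by rewrite tofrac_eq => /eqP <-.
Qed.

Lemma ideal_in_domain (D : idomainType) (I : set D) :
  ideal_in I `<=` domain_in D.
Proof. by move=> _ [d _ <-]; exists d. Qed.

Lemma span_gen (D : idomainType) n (g : 'I_n -> {fraction D}) i :
  span g (g i).
Proof.
exists (fun j => (j == i)%:R) => //.
rewrite (bigD1 i) //= eqxx tofrac1 mul1r big1 ?addr0 // => j /negbTE ->.
by rewrite tofrac0 mul0r.
Qed.

(** The closure properties are listed one by one because [E] may be the zero submodule, which
    [nz_submodule] excludes. *)
Lemma span_sub (D : idomainType) n (g : 'I_n -> {fraction D})
    (E : set {fraction D}) :
  E 0 -> (forall x y, E x -> E y -> E (x + y)) ->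
  (forall (d : D) x, E x -> E (d%:F * x)) -> (forall i, E (g i)) ->
  span g `<=` E.
Proof.
by move=> E0 ED EM Eg _ [c _ <-]; apply: big_ind => // i _; exact: EM.
Qed.

Lemma span_subm (D : idomainType) n (g : 'I_n -> {fraction D})
    (E : set {fraction D}) :
  nz_submodule E -> (forall i, E (g i)) -> span g `<=` E.
Proof. by case=> E0 ED EM _; exact: span_sub. Qed.

Lemma span_ideal (D : idomainType) n (g : 'I_n -> {fraction D}) (I : set D) :
  ideal I -> (forall i, ideal_in I (g i)) -> span g `<=` ideal_in I.
Proof.
move=> idI Ig; apply: span_sub => //.
- by exists 0; [exact: ideal0|rewrite tofrac0].
- by move=> _ _ [d Id <-] [e Ie <-]; exists (d + e);
    [exact: idealD|rewrite tofracD].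
- by move=> a _ [d Id <-]; exists (a * d); [exact: idealMl|rewrite tofracM].
Qed.

Lemma nz_fg_span (D : idomainType) n (g : 'I_n -> {fraction D}) :
  (exists i, g i != 0) -> nz_fg_submodule (span g).
Proof.
move=> [i gi0]; split; last by exists n, g.
split.
- exists (fun=> 0) => //; apply: big1 => j _; by rewrite tofrac0 mul0r.
- move=> _ _ [c _ <-] [d _ <-]; exists (fun j => c j + d j) => //.
  by rewrite -big_split; apply: eq_bigr => j _; rewrite tofracD mulrDl.
- move=> a _ [c _ <-]; exists (fun j => a * c j) => //.
  by rewrite mulr_sumr; apply: eq_bigr => j _; rewrite tofracM mulrA.
- by exists (g i) => //; exact: span_gen.
Qed.

(** Concatenating the two families of generators gives [H]. This makes the union that defines
    [star_f] a directed one. *)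
Lemma nz_fg_join (D : idomainType) (E F G : set {fraction D}) :
  nz_submodule E -> nz_fg_submodule F -> nz_fg_submodule G ->
  F `<=` E -> G `<=` E ->
  exists H, [/\ nz_fg_submodule H, H `<=` E, F `<=` H & G `<=` H].
Proof.
move=> mE [[_ _ _ [x Fx x0]] [m [f Ff]]] [_ [n [g Gg]]] FE GE; subst F G.
pose h (i : 'I_(m + n)) :=
  match split i with inl i => f i | inr i => g i end.
have hl i : h (lshift n i) = f i by rewrite /h (unsplitK (inl i)).
have hr i : h (rshift m i) = g i by rewrite /h (unsplitK (inr i)).
have fh : span f `<=` span h.
  move=> _ [c _ <-].
  exists (fun i => if split i is inl i then c i else 0) => //.
  rewrite big_split_ord /= [X in _ + X]big1 ?addr0.
    by apply: eq_bigr => i _; rewrite hl (unsplitK (inl i)).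
  by move=> i _; rewrite (unsplitK (inr i)) tofrac0 mul0r.
have gh : span g `<=` span h.
  move=> _ [c _ <-].
  exists (fun i => if split i is inr i then c i else 0) => //.
  rewrite big_split_ord /= [X in X + _]big1 ?add0r.
    by apply: eq_bigr => i _; rewrite hr (unsplitK (inr i)).
  by move=> i _; rewrite (unsplitK (inl i)) tofrac0 mul0r.
exists (span h); split=> //.
  (* A nonzero element of [F] is a combination of the [h i], so these cannot all vanish. *)
  apply: nz_fg_span; apply: contrapT => /forallNP h0.
  move/negP: x0; apply; case: (fh _ Fx) => c _ <-.
  by rewrite big1 // => i _; move/negP: (h0 i); rewrite negbK => /eqP ->;
    rewrite mulr0.
apply: span_subm => // i; rewrite /h; case: (split i) => j.
  by apply: FE; exact: span_gen.
by apply: GE; exact: span_gen.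
Qed.

(** Induction on [n]: an upper bound of a witness for the first condition and a common witness for
    the others meets them all. It serves both for closures of finitely generated submodules and for
    chains of ideals. *)
Lemma directed_bound (T : Type) (A : set T) (R : T -> T -> Prop) n
    (B : 'I_n -> set T) :
  A !=set0 ->
  (forall s t, A s -> A t -> exists u, [/\ A u, R s u & R t u]) ->
  (forall i s t, R s t -> B i s -> B i t) ->
  (forall i, exists2 t, A t & B i t) ->
  exists2 t, A t & forall i, B i t.
Proof.
move=> A0 dirA; elim: n B => [|n IHn] B upB exB.
  by case: A0 => t At; exists t => // -[].
have [||t At Bt] := IHn (fun i => B (lift ord0 i)); [by move=> i; exact: upB| |].
  by move=> i; exact: exB.
have [s As Bs] := exB ord0.
have [u [Au su tu]] := dirA _ _ As At; exists u => // i.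
by case: (unliftP ord0 i) => [j|] ->; [exact: upB tu _|exact: upB su _].
Qed.

(** * The finite-type operation [star_f] *)

Lemma star_subset_idem (D : idomainType)
    (star : set {fraction D} -> set {fraction D}) (E F : set {fraction D}) :
  semistar star -> nz_submodule E -> nz_submodule F -> E `<=` star F ->
  star E `<=` star F.
Proof.
move=> sstar mE mF EF; rewrite -(semistar_idem sstar mF).
by apply: semistar_mono => //; exact: semistar_submodule.
Qed.

Lemma star_f_sub (D : idomainType)
    (star : set {fraction D} -> set {fraction D}) (E F : set {fraction D}) :
  E `<=` F -> star_f star E `<=` star_f star F.
Proof. by move=> EF x [G [fG GE] Gx]; exists G => //; split=> // y /GE /EF. Qed.

Lemma star_f_ext (D : idomainType)
    (star : set {fraction D} -> set {fraction D}) (E : set {fraction D}) :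
  semistar star -> nz_submodule E -> E `<=` star_f star E.
Proof.
move=> sstar mE x Ex; case: (mE) => _ _ _ [y Ey y0].
(* The nonzero [y] keeps the span nonzero even when [x] is zero. *)
pose g (i : 'I_2) := if i == ord0 then x else y.
have fg : nz_fg_submodule (span g) by apply: nz_fg_span; exists ord_max.
exists (span g).
  by split=> //; apply: span_subm => // i; rewrite /g; case: ifP.
by apply: semistar_ext; [|case: fg|exact: (span_gen g ord0)].
Qed.

(** Finite character: the closures of finitely generated submodules of [E] are directed, so a single
    one contains all the [g i]. *)
Lemma star_f_fg (D : idomainType)
    (star : set {fraction D} -> set {fraction D}) (E : set {fraction D})
    n (g : 'I_n -> {fraction D}) :
  semistar star -> nz_submodule E -> (forall i, star_f star E (g i)) ->
  exists F, [/\ nz_fg_submodule F, F `<=` E & forall i, star F (g i)].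
Proof.
move=> sstar mE Eg.
have [||||F [fF FE] Fg] := @directed_bound (set {fraction D})
  [set F | nz_fg_submodule F /\ F `<=` E]
  (fun F G => star F `<=` star G) n (fun i => [set F | star F (g i)]).
- case: (mE) => E0 _ _ [y Ey y0].
  by case: (star_f_ext sstar mE E0) => F [fF FE] _; exists F.
- move=> F G [fF FE] [fG GE].
  have [H [fH HE FH GH]] := nz_fg_join mE fF fG FE GE.
  by exists H; split=> //; apply: semistar_mono => //;
    [case: fF|case: fH|case: fG|case: fH].
- by move=> i F G FG; exact: FG.
- by move=> i; case: (Eg i) => F [fF FE] Fg; exists F.
by exists F.
Qed.

Lemma star_f_submodule (D : idomainType)
    (star : set {fraction D} -> set {fraction D}) (E : set {fraction D}) :
  semistar star -> nz_submodule E -> nz_submodule (star_f star E).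
Proof.
move=> sstar mE; have ext := star_f_ext sstar mE.
case: (mE) => E0 _ _ [y Ey y0]; split; [exact: ext| | |by exists y; [exact: ext|]].
- move=> x z Ex Ez.
  have [|F [fF FE Fg]] :=
    @star_f_fg D star E 2 (fun i => if i == ord0 then x else z) sstar mE.
    by move=> i; case: ifP.
  exists F => //.
  apply: (nz_submoduleD (semistar_submodule sstar fF.1)).
    exact: (Fg ord0).
  exact: (Fg ord_max).
- move=> d x [F [fF FE] Fx]; exists F => //.
  exact: (nz_submoduleM (semistar_submodule sstar fF.1)).
Qed.

(** The generators of a finitely generated [G] below [F] lie in [star H] for a single finitely
    generated [H] below [E]; idempotence of [star] then puts [star G] inside [star H]. *)
Lemma star_f_idem (D : idomainType)
    (star : set {fraction D} -> set {fraction D}) (E F : set {fraction D}) :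
  semistar star -> nz_submodule E -> F `<=` star_f star E ->
  star_f star F `<=` star_f star E.
Proof.
move=> sstar mE FE x [G [fG GF] Gx]; case: (fG) => mG [n [g Gg]].
have [i|H [fH HE Hg]] := @star_f_fg D star E n g sstar mE.
  by apply: FE; apply: GF; rewrite Gg; exact: span_gen.
exists H => //; apply: star_subset_idem Gx => //; first exact: fH.1.
by rewrite Gg; apply: span_subm => //; apply: semistar_submodule => //; exact: fH.1.
Qed.

Lemma prime_ideal_contraction (D : idomainType) (Q : set {poly D}) :
  prime_ideal Q -> prime_ideal (contraction Q).
Proof.
move=> pQ; have idQ := prime_ideal_ideal pQ.
apply/prime_idealE; split; rewrite /contraction /=.
- apply/idealE; split=> [|a u v Qu Qv] /=; first by rewrite polyC0; exact: ideal0.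
  by rewrite polyCD polyCM; apply: idealD => //; exact: idealMl.
- by rewrite polyC1; exact: prime_ideal_not1.
- by move=> u v; rewrite polyCM; exact: prime_idealM.
Qed.

Lemma tofrac_divff (R : idomainType) (x : R) : x != 0 -> 1 = x%:F / x%:F.
Proof. by move=> x0; rewrite divff // tofrac_eq0. Qed.

Lemma tofrac_div1 (R : idomainType) (x : {fraction R}) : x = x / 1%:F.
Proof. by rewrite tofrac1 divr1. Qed.

(** * Maximal quasi-ideals, and the quasi-primes of [star_tilde] and [star_X] *)

Lemma star_f_proper_not1 (D : idomainType)
    (star : set {fraction D} -> set {fraction D}) (I : set D) :
  semistar star -> ideal I -> ~ star_f star (ideal_in I) 1 -> ~ I 1.
Proof.
move=> sstar idI nI I1; apply: nI; apply: star_f_ext => //.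
  apply: nz_submodule_ideal => // I0; move: I1; rewrite I0 => /eqP.
  by rewrite oner_eq0.
by exists 1; rewrite ?tofrac1.
Qed.

(** Zorn's lemma on the ideals above [I] whose [star_f]-closure omits 1. A maximal one is a
    quasi-ideal: the trace of its closure on [D] is again such an ideal, because [star_f] is
    idempotent. *)
Lemma exists_QMax (D : idomainType)
    (star : set {fraction D} -> set {fraction D}) (I : set D) :
  semistar star -> ideal I -> I <> [set 0] ->
  ~ star_f star (ideal_in I) 1 ->
  exists2 M, QMax (star_f star) M & I `<=` M.
Proof.
move=> sstar idI In0 nI.
(* [Zorn_bigcup] also asks for the union of the empty chain. *)
pose good A := A = set0 \/
  [/\ ideal A, I `<=` A & ~ star_f star (ideal_in A) 1].
have [F goodF totF|M [gM maxM]] := @Zorn_bigcup D good.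
  have [[A [FA An0]]|F0] := pselect (exists A, F A /\ A <> set0); last first.
    left; apply/seteqP; split=> // x [A FA Ax]; apply: F0.
    by exists A; split=> // A0; move: Ax; rewrite A0.
  have idF B x : F B -> B x -> [/\ ideal B, I `<=` B
      & ~ star_f star (ideal_in B) 1].
    by move=> FB Bx; case: (goodF _ FB) => // B0; move: Bx; rewrite B0.
  have [x Ax] : A !=set0 by apply/set0P/eqP.
  have [idA IA nA] := idF _ _ FA Ax.
  have idU : ideal (\bigcup_(X in F) X).
    apply/idealE; split; first by exists A => //; exact: ideal0.
    move=> a u v [B FB Bu] [C FC Cv].
    have [idB _ _] := idF _ _ FB Bu; have [idC _ _] := idF _ _ FC Cv.
    have [BC|CB] := totF _ _ FB FC.
      by exists C => //; apply: idealD => //; apply: idealMl => //; exact: BC.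
    exists B => //; apply: idealD => //; last exact: CB.
    exact: idealMl.
  right; split=> //; first by move=> y Iy; exists A => //; exact: IA.
  case=> G [fG GU] G1; case: (fG) => mG [n [g Gg]].
  (* The finitely many generators of [G] lie in one member [B] of the chain, whose closure would
     then contain 1. *)
  have [||||B FB Bg] :=
    @directed_bound (set D) F subset n (fun i B => ideal_in B (g i)).
  - by exists A.
  - move=> B C FB FC; have [BC|CB] := totF _ _ FB FC.
      by exists C; split.
    by exists B; split.
  - by move=> i B C BC [d Bd <-]; exists d => //; exact: BC.
  - move=> i; have [|d [B FB Bd] dg] := GU (g i).
      by rewrite Gg; exact: span_gen.
    by exists B => //; exists d.
  (* An empty [B] leaves no generators at all, and [G] would be zero. *)
  case: (goodF _ FB) => [B0|[idB _ []]].
    case: mG => _ _ _ [y Gy y0]; move: y0 Gy; rewrite Gg => y0 [c _ cy].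
    move: y0; rewrite -cy big1 ?eqxx // => i _.
    by case: (Bg i) => d; rewrite B0.
  by exists G => //; split=> //; rewrite Gg; exact: span_ideal.
have [idM IM nM] : [/\ ideal M, I `<=` M & ~ star_f star (ideal_in M) 1].
  case: gM => // M0; exfalso; apply: (maxM I); last by right; split.
  rewrite M0; split; first by [].
  by move=> /(_ 0 (ideal0 idI)).
have Mn0 : M <> [set 0].
  move=> M0; apply: In0; apply/seteqP; split=> [x /IM|x ->]; first by rewrite M0.
  exact: ideal0.
have maxM' A : ideal A -> M `<=` A -> ~ star_f star (ideal_in A) 1 -> A = M.
  move=> idA MA nA; apply: contrapT => AM; apply: (maxM A).
    by split=> // AM'; apply: AM; apply/seteqP.
  by right; split=> //; exact: subset_trans MA.
have mM := nz_submodule_ideal idM Mn0.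
exists M => //; split; last first.
  move=> A [[idA An0 qA] AT] MA; apply: maxM' => // A1; apply: AT.
  have {}A1 : A 1 by rewrite -qA /= tofrac1.
  by apply/seteqP; split=> // x _; rewrite -[x]mulr1; exact: idealMl.
have mfM := star_f_submodule sstar mM.
split; last by move=> MT; apply: (star_f_proper_not1 sstar idM nM); rewrite MT.
split=> //; apply: maxM'.
- apply/idealE; split=> [|a u v Mu Mv] /=.
    by rewrite tofrac0; exact: nz_submodule0.
  by rewrite tofracD tofracM; apply: nz_submoduleD => //; exact: nz_submoduleM.
- by move=> d Md; apply: star_f_ext => //; exists d.
- move=> M1; apply: nM; apply: (star_f_idem sstar mM) M1.
  by move=> _ [d Md <-].
Qed.

(** If 1 lies in the closure of [P], no [M] in [QMax] contains [P], so every extension of [P] to a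
    local ring [D_M] contains 1. Otherwise some [M] contains [P], and extending [P] to [D_M] adds no
    element of [D], since denominators outside [M] are outside [P]. *)
Lemma quasi_star_prime_tildeE (D : idomainType)
    (star : set {fraction D} -> set {fraction D}) (P : set D) :
  semistar star ->
  quasi_star_prime (star_tilde star) P <->
  [/\ prime_ideal P, P <> [set 0] & ~ star_f star (ideal_in P) 1].
Proof.
move=> sstar; split=> [[pP [idP P0 qP]]|[pP P0 nP]].
  split=> // P1; apply: (prime_ideal_not1 pP); rewrite -qP /= => M.
  move=> [[[idM M0 qM] MT] _].
  have [PM|/existsNP [p /not_implyP [Pp nMp]]] := pselect (P `<=` M).
    exfalso; apply: MT; apply/seteqP; split=> // x _; rewrite -[x]mulr1.
    apply: idealMl => //; rewrite -qM /= tofrac1; apply: star_f_sub P1.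
    by move=> _ [d Pd <-]; exists d => //; exact: PM.
  (* The element 1 is [p] times its inverse, a fraction allowed in [D_M] as [p] is outside [M]. *)
  exists 1%N, (fun=> p%:F), (fun=> 1%:F / p%:F); split=> [_|_|].
  - by exists p.
  - by exists 1, p.
  - rewrite big_ord1 tofrac1 mulrCA mul1r divff // tofrac_eq0.
    by apply/eqP => p0; apply: nMp; rewrite p0; exact: ideal0.
have idP := prime_ideal_ideal pP.
split=> //; split=> //; apply/seteqP; split=> d /=; last first.
  move=> Pd M [[[idM _ _] MT] _]; exists 1%N, (fun=> d%:F), (fun=> 1).
  split=> [_|_|]; [by exists d| |by rewrite big_ord1 mulr1].
  exists 1, 1; split; last by rewrite tofrac1 divr1.
  move=> M1; apply: MT; apply/seteqP; split=> // x _.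
  by rewrite -[x]mulr1; exact: idealMl.
have [M QM PM] := exists_QMax sstar idP P0 nP.
move=> /(_ M QM) [n [a [b [Pa Mb dE]]]].
have {Mb} /choice [s sE] i : exists s, exists c, ~ P s /\ b i = c%:F / s%:F.
  by have [c [s [nMs bE]]] := Mb i; exists s, c; split=> // /PM.
have s0 i : s i != 0.
  by case: (sE i) => c [nPs _]; apply/eqP => si0; apply: nPs; rewrite si0;
    exact: ideal0.
(* Clear all denominators at once; none of them is in [P], so primality leaves [d] in [P]. *)
have : P (d * \prod_i s i).
  apply/ideal_in_tofrac; rewrite tofracM dE mulr_suml.
  suff H i : ideal_in P (a i * b i * (\prod_j s j)%:F).
    case: (nz_submodule_ideal idP P0) => E0 ED _ _.
    by apply: big_ind => // i _; exact: H.
  rewrite (bigD1 i) //= tofracM; have [c [_ ->]] := sE i.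
  rewrite -!mulrA [(s i)%:F^-1 * _]mulrA mulVf ?tofrac_eq0 // mul1r -tofracM.
  by have [e Pe <-] := Pa i; rewrite -tofracM; exists (e * (c * \prod_(j | j != i) s j));
    [exact: idealMr|].
case/(prime_idealM pP) => // /(prime_ideal_prod pP) [i Psi].
by case: (sE i) => c [].
Qed.

(** The two clauses of [Theta1] merge: the closure of the zero ideal is empty, as no nonzero
    submodule fits inside it, and the closure of any ideal lies in [star (domain_in D)], filling it
    exactly when it contains 1. *)
Lemma Theta1E (D : idomainType)
    (star : set {fraction D} -> set {fraction D}) (Q : set {poly D}) :
  semistar star ->
  Theta1 star Q <->
  prime_ideal Q /\ ~ star_f star (ideal_in (contraction Q)) 1.
Proof.
move=> sstar; split=> [[pQ tQ]|[pQ nQ]]; split=> //.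
  case: tQ => [->|[_ tQ]] [F [fF FQ] F1].
    case: fF => -[_ _ _ [x Fx x0]] _; case: (FQ _ Fx) => d d0 xE.
    by move: x0; rewrite -xE d0 tofrac0 eqxx.
  apply: tQ => x Dx; exists F => //; apply: star_subset_idem Dx => //.
  - exact: nz_submodule_domain.
  - exact: fF.1.
  - move=> _ [d _ <-]; rewrite -[d%:F]mulr1.
    exact: (nz_submoduleM (semistar_submodule sstar fF.1)).
right; split=> [x [F [fF FQ]]|sub].
  apply: semistar_mono => //; [exact: fF.1|exact: nz_submodule_domain|].
  by move=> y /FQ; exact: ideal_in_domain.
apply: nQ; apply: sub; apply: semistar_ext => //.
  exact: nz_submodule_domain.
by exists 1; rewrite ?tofrac1.
Qed.

(** If the closure of the contraction omits 1, then [Q] is in [Theta1] and each denominator has a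
    coefficient outside [Q]. If it contains 1, some denominator has all its coefficients in [Q], and
    the closure of [Q] contains 1. *)
Lemma quasi_star_prime_XE (D : idomainType)
    (star : set {fraction D} -> set {fraction D}) (Q : set {poly D}) :
  semistar star ->
  quasi_star_prime (star_X star) Q <->
  [/\ prime_ideal Q, Q <> [set 0]
    & ~ star_f star (ideal_in (contraction Q)) 1].
Proof.
move=> sstar; split=> [[pQ [idQ Q0 qQ]]|[pQ Q0 nQ]]; last first.
  have idQ := prime_ideal_ideal pQ.
  have tQ : Theta1 star Q by apply/Theta1E.
  split=> //; split=> //; apply/seteqP; split=> d /=.
    move=> [f [s [Qf Ss fE]]].
    have /existsNP [i nQi] : ~ poly_in Q s by move=> Qs; apply: Ss; exists Q.
    have s0 : s != 0.
      by apply/eqP => s0; apply: nQi; rewrite s0 coef0; exact: ideal0.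
    have {}fE : d%:F%:P * map_poly tofrac s = f.
      apply/eqP; rewrite -tofrac_eq tofracM fE mulfVK // tofrac_eq0.
      by rewrite map_poly_eq0_id0 // tofrac_eq0 lead_coef_eq0.
    (* Compare the coefficients of index [i] in [d * s = f]. *)
    have : Q (d * s`_i).
      apply/ideal_in_tofrac; move: (Qf i).
      by rewrite -fE coefCM coef_map_id0 ?tofrac0 // tofracM.
    by case/(prime_idealM pQ).
  move=> Qd; exists d%:F%:P, 1; split.
  - move=> i; rewrite coefC; case: ifP => _; first by exists d.
    by exists 0; [exact: ideal0|rewrite tofrac0].
  - move=> [Q' [pQ' _] Q'1]; apply: (prime_ideal_not1 pQ').
    by have := Q'1 0%N; rewrite coef1.
  - suff -> : map_poly tofrac (1 : {poly {poly D}}) = 1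
        :> {poly {fraction {poly D}}} by exact: tofrac_div1.
    apply/polyP => i; rewrite coef_map_id0 ?tofrac0 // !coef1.
    by case: eqP; rewrite ?tofrac0 ?tofrac1.
split=> // -[F [fF FQ] F1]; apply: (prime_ideal_not1 pQ); rewrite -qQ /=.
case: (fF) => mF [n [g Fg]].
have {FQ} /choice [d dE] i : exists d, Q d%:P /\ d%:F = g i.
  by have [|d Qd dE] := FQ (g i); [rewrite Fg; exact: span_gen|exists d].
(* The coefficients of [s] generate [F], whose closure contains 1, so no prime in [Theta1] contains
   them all. *)
pose s : {poly {poly D}} := \sum_(i < n) (d i)%:P *: 'X^i.
have sE (i : 'I_n) : s`_i = (d i)%:P.
  rewrite coef_sum (bigD1 i) //= coefZ coefXn eqxx mulr1 big1 ?addr0 // => j ji.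
  by rewrite coefZ coefXn eq_sym (inj_eq val_inj) (negbTE ji) mulr0.
have Ss : S1 star s.
  move=> [Q' /(Theta1E _ sstar) [pQ' nQ'] Q's]; apply: nQ'; exists F => //.
  split=> //; rewrite Fg; apply: span_ideal => [|i].
    exact: prime_ideal_ideal (prime_ideal_contraction pQ').
  by exists (d i); rewrite ?(dE i).2 // /contraction /= -sE; exact: Q's.
have s0 : s != 0.
  apply/eqP => s0; case: mF => _ _ _ [y Fy]; move: Fy; rewrite Fg => -[c _ <-].
  rewrite big1 ?eqxx // => i _; rewrite -(dE i).2.
  have /eqP := sE i; rewrite s0 coef0 eq_sym polyC_eq0 => /eqP ->.
  by rewrite tofrac0 mulr0.
exists (map_poly tofrac s), s; split=> // [i|].
  rewrite coef_map_id0 ?tofrac0 //; exists (s`_i) => //; rewrite coef_sum.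
  apply: ideal_sum => // j _; rewrite coefZ; apply: idealMr => //.
  exact: (dE j).1.
have -> : ((1 : {poly D})%:F%:P)%:F = 1 :> {fraction {poly {fraction {poly D}}}}.
  by rewrite (tofrac1 {poly D}) polyC1 tofrac1.
by apply: tofrac_divff; rewrite map_poly_eq0_id0 // tofrac_eq0 lead_coef_eq0.
Qed.

(** * Primes of [D[X]] built from a prime of [D] *)

Lemma contraction_poly_in (D : idomainType) (P : set D) :
  ideal P -> contraction (poly_in P) = P.
Proof.
move=> idP; apply/seteqP; split=> d; first by move=> /(_ 0%N); rewrite coefC.
by move=> Pd i; rewrite coefC; case: ifP => // _; exact: ideal0.
Qed.

(** Gauss's argument: if [i] and [j] are the first indices of coefficients of [f] and [g] outside
    [P], the coefficient of index [i + j] of the product is the product of these two modulo [P]. *)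
Lemma prime_ideal_poly_in (D : idomainType) (P : set D) :
  prime_ideal P -> prime_ideal (poly_in P).
Proof.
move=> pP; have idP := prime_ideal_ideal pP; apply/prime_idealE; split.
- apply/idealE; split=> [i|f g h Pg Ph i]; first by rewrite coef0; exact: ideal0.
  rewrite coefD; apply: idealD => //; rewrite coefM; apply: ideal_sum => // j _.
  exact: idealMl.
- by move=> /(_ 0%N); rewrite coef1; exact: prime_ideal_not1.
move=> f g Pfg; apply: contrapT => /not_orP [nPf nPg].
have first_out (h : {poly D}) : ~ poly_in P h ->
    exists i, ~ P h`_i /\ forall j, (j < i)%N -> P h`_j.
  move=> nPh; have /existsNP [i0 ni0] := nPh.
  have exi : exists i, `[< ~ P h`_i >] by exists i0; apply/asboolP.
  case: (ex_minnP exi) => i /asboolP ni mini; exists i; split=> // j ji.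
  by apply: contrapT => /asboolP /mini; rewrite leqNgt ji.
have [i [nfi fi]] := first_out f nPf; have [j [ngj gj]] := first_out g nPg.
have iij : (i < (i + j).+1)%N by rewrite ltnS leq_addr.
have := Pfg (i + j)%N; rewrite coefM (bigD1 (Ordinal iij)) //= addKn => Ps.
suff : P (f`_i * g`_j) by case/(prime_idealM pP).
rewrite -[f`_i * _](addrK (\sum_(k < (i + j).+1 | k != Ordinal iij)
  f`_k * g`_(i + j - k)%N)); apply: idealB => //; apply: ideal_sum => // k ki.
have [ki'|ik] := ltnP k i; first by apply: idealMr => //; exact: fi.
apply: idealMl => //; apply: gj.
have {ki} : (i < k)%N.
  by rewrite ltn_neqAle ik andbT; apply: contra ki => /eqP ik'; apply/eqP/val_inj.
by have := ltn_ord k; rewrite ltnS; lia.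
Qed.

(** This is the ideal [(P, X)], the preimage of [P] under evaluation at 0. *)
Lemma prime_ideal_coef0 (D : idomainType) (P : set D) :
  prime_ideal P -> prime_ideal [set f : {poly D} | P f`_0].
Proof.
move=> pP; have idP := prime_ideal_ideal pP; apply/prime_idealE; split=> /=.
- apply/idealE; split=> [|f g h Pg Ph] /=; first by rewrite coef0; exact: ideal0.
  by rewrite coefD coef0M; apply: idealD => //; exact: idealMl.
- by rewrite coef1; exact: prime_ideal_not1.
- by move=> f g; rewrite coef0M; exact: prime_idealM.
Qed.

Lemma poly_in_contraction (D : idomainType) (Q : set {poly D}) :
  ideal Q -> poly_in (contraction Q) `<=` Q.
Proof.
move=> idQ f Qf; rewrite -[f]coefK poly_def; apply: ideal_sum => // i _.
by rewrite -mul_polyC; apply: idealMr => //; exact: Qf.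
Qed.

(** * Local divisibility, and primes of [D[X]] with equal contraction *)

(* [D_P] is a valuation domain. *)
Lemma PstarMD_local_total (D : idomainType)
    (star : set {fraction D} -> set {fraction D}) (P : set D) (a b : D) :
  semistar star -> PstarMD star -> prime_ideal P ->
  ~ star_f star (ideal_in P) 1 ->
  exists2 s, ~ P s & (exists c, s * a = b * c) \/ (exists c, s * b = a * c).
Proof.
move=> sstar pmd pP nP; have idP := prime_ideal_ideal pP.
have [->|a0] := eqVneq a 0.
  by exists 1; [exact: prime_ideal_not1|left; exists 0; rewrite !mulr0].
pose g (i : 'I_2) := if i == ord0 then a%:F else b%:F.
have fI : nz_fg_submodule (span g).
  by apply: nz_fg_span; exists ord0; rewrite tofrac_eq0.
have : star_f star (submodule_mul (span g) (submodule_inv (span g))) 1.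
  rewrite (pmd _ fI); apply: semistar_ext => //; first exact: nz_submodule_domain.
  by exists 1; rewrite ?tofrac1.
(* If no [s] outside [P] worked, the product of [(a, b)] and its inverse would lie in [P], putting 1
   in the closure of [P]. *)
apply: contraPP => nex; case=> F [fF FI] F1; apply: nP; exists F => //.
split=> // _ /FI [n [x [y [Ix Jy ->]]]].
suff {FI} H i : ideal_in P (x i * y i).
  have [E0 ED] : ideal_in P 0 /\ forall u v, ideal_in P u -> ideal_in P v ->
      ideal_in P (u + v).
    split; first by exists 0; [exact: ideal0|rewrite tofrac0].
    by move=> _ _ [d Id <-] [e Ie <-]; exists (d + e);
      [exact: idealD|rewrite tofracD].
  by apply: big_ind => // i _; exact: H.
have [c _ <-] := Ix i; rewrite big_ord_recl big_ord1 /g /= mulrDl -!mulrA.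
have [d _ ayd] : domain_in D (a%:F * y i).
  apply: (Jy i); exists a%:F; last by rewrite mulrC.
  exact: (span_gen g ord0).
have [e _ bye] : domain_in D (b%:F * y i).
  apply: (Jy i); exists b%:F; last by rewrite mulrC.
  exact: (span_gen g ord_max).
(* By this equation, [d] or [e] could serve as [s] if it were outside [P]. *)
have ae_bd : a * e = b * d.
  apply/eqP; rewrite -tofrac_eq !tofracM ayd bye; apply/eqP.
  by rewrite mulrCA.
have Pd : P d.
  apply: contrapT => nPd; apply: nex; exists d => //; right; exists e.
  by rewrite ae_bd mulrC.
have Pe : P e.
  apply: contrapT => nPe; apply: nex; exists e => //; left; exists d.
  by rewrite -ae_bd mulrC.
exists (c ord0 * d + c (lift ord0 ord0) * e).
  by apply: idealD => //; exact: idealMl.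
by rewrite tofracD !tofracM ayd bye.
Qed.

(** In the valuation domain [D_P] some coefficient divides all the others, and [s] is a common
    denominator of the quotients. The induction compares the current divisor with one further
    coefficient at a time. *)
Lemma PstarMD_local_content (D : idomainType)
    (star : set {fraction D} -> set {fraction D}) (P : set D) (f : {poly D}) :
  semistar star -> PstarMD star -> prime_ideal P ->
  ~ star_f star (ideal_in P) 1 ->
  exists i s, ~ P s /\ forall j, exists c, s * f`_j = f`_i * c.
Proof.
move=> sstar pmd pP nP.
suff [i [s [nPs sf]]] : exists i s, ~ P s /\
    forall j, (j < size f)%N -> exists c, s * f`_j = f`_i * c.
  exists i, s; split=> // j; have [/sf //|fj] := ltnP j (size f).
  by exists 0; rewrite nth_default // !mulr0.
elim: (size f) => [|k [i [s [nPs sf]]]].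
  by exists 0%N, 1; split=> //; exact: prime_ideal_not1.
have [t nPt tf] := PstarMD_local_total (f`_i) (f`_k) sstar pmd pP nP.
have nPst : ~ P (s * t) by case/(prime_idealM pP).
case: tf => [[c tf]|[c tf]].
  (* The new coefficient divides the old divisor and takes its place. *)
  exists k, (s * t); split=> // j; rewrite ltnS leq_eqVlt => /orP [/eqP ->|/sf [e sfj]].
    by exists (s * t); rewrite mulrC.
  by exists (c * e); rewrite mulrAC sfj mulrAC -[f`_i * t]mulrC tf mulrA.
exists i, (s * t); split=> // j; rewrite ltnS leq_eqVlt => /orP [/eqP ->|/sf [e sfj]].
  by exists (s * c); rewrite -mulrA tf mulrCA.
by exists (e * t); rewrite mulrAC sfj mulrA.
Qed.

(* Over the valuation domain [D_P], [P = Q' :&: D], a polynomial in [Q] outside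
   [(Q :&: D)[X]] is a constant outside [Q] times a polynomial with a unit
   coefficient; the latter lies in [Q] but not in [P[X]]. *)
Lemma extended_prime_sub (D : idomainType)
    (star : set {fraction D} -> set {fraction D}) (Q Q' : set {poly D}) :
  semistar star -> PstarMD star -> prime_ideal Q -> prime_ideal Q' ->
  ~ star_f star (ideal_in (contraction Q')) 1 -> Q `<=` Q' ->
  Q' = poly_in (contraction Q') -> Q = poly_in (contraction Q).
Proof.
move=> sstar pmd pQ pQ' nQ' QQ' Q'E.
have idQ := prime_ideal_ideal pQ.
apply/seteqP; split; last exact: poly_in_contraction.
move=> f Qf; apply: contrapT => nf.
have [i [s [nQs sf]]] := PstarMD_local_content f sstar pmd
  (prime_ideal_contraction pQ') nQ'.
case/choice: sf => c sf.
have pP := prime_ideal_contraction pQ.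
have nQfi : ~ contraction Q f`_i.
  move=> Qfi; apply: nf => j; have : contraction Q (s * f`_j).
    by rewrite sf; apply: idealMr Qfi; exact: prime_ideal_ideal.
  by case/(prime_idealM pP) => // Qs; case: nQs; exact: QQ'.
have fi0 : f`_i != 0.
  apply/eqP => fi0; apply: nQfi; rewrite fi0; apply: ideal0.
  exact: prime_ideal_ideal.
have isz : (i < size f)%N.
  by rewrite ltnNge; apply: contra fi0 => fi; rewrite nth_default.
(* This makes [s], which is outside [Q'], a coefficient of [g]. *)
have ci : c i = s by apply: (mulfI fi0); rewrite -sf mulrC.
pose g := \poly_(j < size f) c j.
have sfg : s%:P * f = (f`_i)%:P * g.
  apply/polyP => j; rewrite !coefCM coef_poly; case: ltnP => [_|fj]; first exact: sf.
  by rewrite nth_default // !mulr0.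
have : Q ((f`_i)%:P * g) by rewrite -sfg; exact: idealMl.
case/(prime_idealM pQ) => // /QQ'; rewrite Q'E => /(_ i).
by rewrite coef_poly isz ci.
Qed.

(** Take [f] of least size. Were its leading coefficient in [Q], dropping the leading term would
    give a smaller element of [Q], hence one with all coefficients in [Q], and [f] would be such
    too. *)
Lemma min_size_not_extended (D : idomainType) (Q : set {poly D}) f0 :
  ideal Q -> Q f0 -> ~ poly_in (contraction Q) f0 ->
  exists f, [/\ Q f, ~ contraction Q (lead_coef f) &
    forall g, Q g -> (size g < size f)%N -> poly_in (contraction Q) g].
Proof.
move=> idQ Qf0 nf0.
pose bad k := exists f : {poly D},
  [/\ Q f, ~ poly_in (contraction Q) f & size f = k].
have exk : exists k, `[< bad k >] by exists (size f0); apply/asboolP; exists f0.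
case: (ex_minnP exk) => _ /asboolP [f [Qf nf <-]] minf.
have {}minf g : Q g -> (size g < size f)%N -> poly_in (contraction Q) g.
  move=> Qg gf; apply: contrapT => ng.
  have /asboolP /minf : bad (size g) by exists g.
  by rewrite leqNgt gf.
exists f; split=> // Qlc; pose h := lead_coef f *: 'X^((size f).-1).
have Qh : Q h by rewrite /h -mul_polyC; exact: idealMr.
have f_gt0 : (0 < size f)%N.
  rewrite lt0n size_poly_eq0; apply/eqP => f0E; apply: nf => i.
  by rewrite f0E coef0 /contraction /= polyC0; exact: ideal0.
have fh : (size (f - h)%R < size f)%N.
  rewrite -[ltnRHS](prednK f_gt0) ltnS; apply/leq_sizeP => j.
  rewrite coefB coefZ coefXn leq_eqVlt => /orP [/eqP <-|fj].
    by rewrite eqxx mulr1 lead_coefE subrr.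
  rewrite nth_default; last by rewrite -(prednK f_gt0).
  by rewrite gtn_eqF // mulr0 subrr.
have {}fh := minf _ (idealB idQ Qf Qh) fh.
apply: nf => i; rewrite -(subrK h f) coefD /contraction /= polyCD.
apply: idealD => //; first exact: fh.
by rewrite coefZ polyCM; exact: idealMr.
Qed.

(** The fibre over a prime [P] is a polynomial ring over a field, where a nonzero prime is maximal.
    The proof replaces division there by pseudo-division by [f'], an element of least size of [Q']
    outside [P[X]]. *)
Lemma extended_prime_fiber (D : idomainType) (Q Q' : set {poly D}) :
  prime_ideal Q -> prime_ideal Q' -> Q `<` Q' ->
  contraction Q = contraction Q' -> Q = poly_in (contraction Q).
Proof.
move=> pQ pQ' [QQ' nQ'Q] PE.
have idQ := prime_ideal_ideal pQ; have idQ' := prime_ideal_ideal pQ'.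
have PQ := poly_in_contraction idQ.
apply/seteqP; split=> // f0 Qf0; apply: contrapT => nf0.
have [f [Qf nlf minf]] := min_size_not_extended idQ Qf0 nf0.
have [||f' [Q'f' nlf' minf']] := @min_size_not_extended _ Q' f0 idQ'.
- exact: QQ'.
- by rewrite -PE.
rewrite -PE in nlf' minf'.
have pP := prime_ideal_contraction pQ; have idP := prime_ideal_ideal pP.
have nP0 h : ~ contraction Q (lead_coef h) -> h != 0.
  by move=> nlh; apply/eqP => h0; apply: nlh; rewrite h0 lead_coef0; exact: ideal0.
have f'0 := nP0 _ nlf'.
have divf' h : Q' h -> exists k r, poly_in (contraction Q) r /\
    (lead_coef f' ^+ k)%:P * h = Pdiv.Idomain.divp h f' * f' + r.
  move=> Q'h; have := Pdiv.Idomain.divp_eq h f'; rewrite -mul_polyC => E.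
  exists (Pdiv.Idomain.scalp h f'), (Pdiv.Idomain.modp h f'); split=> //.
  apply: minf'; last by rewrite Pdiv.Idomain.ltn_modp.
  have -> : Pdiv.Idomain.modp h f' = (lead_coef f' ^+ Pdiv.Idomain.scalp h f')%:P * h
      - Pdiv.Idomain.divp h f' * f' by rewrite E addrAC subrr add0r.
  by apply: idealB => //; exact: idealMl.
have nPX k : ~ contraction Q (lead_coef f' ^+ k) by move/(prime_idealX pP).
(* Otherwise each element of [Q'], times a constant outside [Q], would lie in [Q], forcing [Q'] into
   [Q]. *)
have nQf' : ~ Q f'.
  move=> Qf'; apply: nQ'Q => h /divf' [k [r [/PQ Qr E]]].
  have : Q ((lead_coef f' ^+ k)%:P * h).
    by rewrite E; apply: idealD => //; exact: idealMl.
  by case/(prime_idealM pQ) => // /nPX.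
have [k [r [Pr E]]] := divf' _ (QQ' _ Qf).
have : Q (Pdiv.Idomain.divp f f' * f').
  have -> : Pdiv.Idomain.divp f f' * f' = (lead_coef f' ^+ k)%:P * f - r.
    by rewrite E addrK.
  by apply: idealB => //; [exact: idealMl|exact: PQ].
case/(prime_idealM pQ) => // Qq.
(* As [f'] is not constant, the quotient is smaller than [f]; lying in [Q], it has all coefficients
   in [P] by minimality of [f]. *)
have f'_gt1 : (1 < size f')%N.
  rewrite ltnNge; apply/negP => /size1_polyC f'C; apply: nlf'.
  by rewrite f'C lead_coefC PE /contraction /= -f'C.
have f_gt0 : (0 < size f)%N by rewrite size_poly_gt0 (nP0 _ nlf).
have Pq : poly_in (contraction Q) (Pdiv.Idomain.divp f f').
  by apply: minf => //; rewrite Pdiv.Idomain.size_divp //; lia.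
have /(_ (size f).-1) : poly_in (contraction Q) ((lead_coef f' ^+ k)%:P * f).
  move=> i; rewrite E coefD; apply: idealD => //; rewrite coefM.
  by apply: ideal_sum => // j _; apply: idealMr => //; exact: Pq.
by rewrite coefCM => /(prime_idealM pP) [/nPX|].
Qed.

(** * Chains of primes and the two dimensions *)

Lemma tilde_chain (D : idomainType)
    (star : set {fraction D} -> set {fraction D}) m (P : nat -> set D) :
  semistar star -> P 0%N = [set 0] ->
  (forall i, (i < m)%N -> P i `<` P i.+1) ->
  (forall i, (i <= m)%N ->
     prime_ideal (P i) /\ ~ star_f star (ideal_in (P i)) 1) ->
  quasi_star_prime_chain (star_tilde star) m P.
Proof.
move=> sstar P0 ltP pP; split=> // i im; apply/(quasi_star_prime_tildeE _ sstar).
have [pPi _] := pP _ (ltnW im); have [pPi1 nPi1] := pP _ im.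
split=> // Pi1; case: (ltP i im) => _; apply; rewrite Pi1 => _ ->.
by apply: ideal0; exact: prime_ideal_ideal.
Qed.

Lemma chain_mono (T : Type) m (P : nat -> set T) :
  (forall i, (i < m)%N -> P i `<` P i.+1) ->
  forall i j, (i <= j)%N -> (j <= m)%N -> P i `<=` P j.
Proof.
move=> ltP i j; elim: j => [|j IHj]; first by rewrite leqn0 => /eqP -> _ x.
rewrite leq_eqVlt => /orP [/eqP -> _ x //|ij] jm.
by move=> x /(IHj ij (ltnW jm)); apply: (ltP j jm).1.
Qed.

(** This lets the zero ideal at the bottom of a chain be treated like the primes above it. *)
Lemma star_f_set0_not1 (D : idomainType)
    (star : set {fraction D} -> set {fraction D}) :
  ~ star_f star (ideal_in [set (0 : D)]) 1.
Proof.
move=> [F [[[_ _ _ [x Fx x0]] _] F0] _]; case: (F0 _ Fx) => d -> xE.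
by move: x0; rewrite -xE tofrac0 eqxx.
Qed.

Lemma contraction_set0 (D : idomainType) :
  contraction [set (0 : {poly D})] = [set 0].
Proof.
apply/seteqP; split; rewrite /contraction => d /=; [move=> /eqP|move=> ->].
  by rewrite polyC_eq0 => /eqP.
by rewrite polyC0.
Qed.

(* Contraction to [D] identifies at most one pair of consecutive primes of a
   chain: from the second prime of such a pair on, no prime is extended from
   [D], whereas the first prime of such a pair is. *)
Lemma star_X_chain_le (D : idomainType)
    (star : set {fraction D} -> set {fraction D}) n m (Q : nat -> set {poly D}) :
  semistar star -> PstarMD star ->
  (forall k P, quasi_star_prime_chain (star_tilde star) k P -> (k <= n)%N) ->
  quasi_star_prime_chain (star_X star) m Q -> (m <= n.+1)%N.
Proof.
move=> sstar pmd dimn [Q0 ltQ qQ]; pose P i := contraction (Q i).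
have {}qQ i : (i <= m)%N ->
    prime_ideal (Q i) /\ ~ star_f star (ideal_in (P i)) 1.
  case: i => [_|i im]; last by case/(quasi_star_prime_XE _ sstar): (qQ i im).
  rewrite /P Q0 contraction_set0; split; first exact: prime_ideal_set0.
  exact: star_f_set0_not1.
have pP i : (i <= m)%N -> prime_ideal (P i) /\ ~ star_f star (ideal_in (P i)) 1.
  by move=> /qQ [pQ nQ]; split=> //; exact: prime_ideal_contraction.
have P0 : P 0%N = [set 0] by rewrite /P Q0 contraction_set0.
have ltP i : (i < m)%N -> P i <> P i.+1 -> P i `<` P i.+1.
  move=> im neP; have PP : P i `<=` P i.+1 by move=> d; apply: (ltQ i im).1.
  by split=> // PP'; apply: neP; apply/seteqP.
have [[k [km Pk]]|neP] := pselect (exists k, (k < m)%N /\ P k = P k.+1); last first.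
  apply: leqW; apply: (dimn _ P); apply: tilde_chain => // i im; apply: ltP => // Pi.
  by apply: neP; exists i.
have not_two i j : (i < j)%N -> (j < m)%N -> P i = P i.+1 -> P j <> P j.+1.
  move=> ij jm Pi Pj; have im := ltn_trans ij jm.
  have Qj := extended_prime_fiber (qQ _ (ltnW jm)).1 (qQ _ jm).1 (ltQ j jm) Pj.
  have Qi1 := extended_prime_sub sstar pmd (qQ _ im).1 (qQ _ (ltnW jm)).1
    (qQ _ (ltnW jm)).2 (chain_mono ltQ ij (ltnW jm)) Qj.
  (* Now [Q i] and [Q i.+1] are both extended from the same prime of [D], against strictness. *)
  have Qi := extended_prime_fiber (qQ _ (ltnW im)).1 (qQ _ im).1 (ltQ i im) Pi.
  by case: (ltQ i im) => _; apply; rewrite Qi1 Qi -/(P i) -/(P i.+1) Pi.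
have {}ltP i : (i < m)%N -> i <> k -> P i `<` P i.+1.
  move=> im ik; apply: ltP => // Pi.
  have [ik'|ki|//] := ltngtP i k; first exact: (not_two i k).
  exact: (not_two k i).
(* [bump k.+1] skips the index [k.+1], whose contraction repeats that of [k]; a chain with [m.-1]
   steps remains. *)
rewrite -(ltn_predK km) ltnS; apply: (dimn _ (fun i => P (bump k.+1 i))).
apply: tilde_chain => // [i im|i im]; last by apply: pP; rewrite /bump; lia.
have [ik|ki|ik] := ltngtP i k.
- have -> : bump k.+1 i = i by rewrite /bump; lia.
  have -> : bump k.+1 i.+1 = i.+1 by rewrite /bump; lia.
  by apply: ltP; lia.
- have -> : bump k.+1 i = i.+1 by rewrite /bump; lia.
  have -> : bump k.+1 i.+1 = i.+2 by rewrite /bump; lia.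
  by apply: ltP; lia.
- rewrite ik; have -> : bump k.+1 k = k by rewrite /bump; lia.
  have -> : bump k.+1 k.+1 = k.+2 by rewrite /bump; lia.
  by rewrite Pk; apply: ltP; lia.
Qed.

Lemma star_X_chain_exists (D : idomainType)
    (star : set {fraction D} -> set {fraction D}) n (P : nat -> set D) :
  semistar star -> quasi_star_prime_chain (star_tilde star) n P ->
  exists Q, quasi_star_prime_chain (star_X star) n.+1 Q.
Proof.
move=> sstar [P0 ltP qP].
have {}qP i : (i <= n)%N ->
    prime_ideal (P i) /\ ~ star_f star (ideal_in (P i)) 1.
  case: i => [_|i im]; last by case/(quasi_star_prime_tildeE _ sstar): (qP i im).
  rewrite P0; split; [exact: prime_ideal_set0|exact: star_f_set0_not1].
(* The second branch is [(P n, X)], used at index [n.+1] only; ['X] separates it from the extension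
   of [P n]. *)
pose Q i := if (i <= n)%N then poly_in (P i) else [set f : {poly D} | P n f`_0].
have pPn := (qP n (leqnn n)).1; have idPn := prime_ideal_ideal pPn.
have Pn_coef0 : poly_in (P n) `<=` [set f : {poly D} | P n f`_0].
  by move=> f; exact.
have X_coef0 : P n ('X : {poly D})`_0 by rewrite coefX; exact: ideal0.
have nX : ~ poly_in (P n) 'X.
  by move=> /(_ 1%N); rewrite coefX; exact: prime_ideal_not1.
exists Q; split.
- rewrite /Q /= P0; apply/seteqP; split=> f => [f0|-> i]; last by rewrite coef0.
  by apply/polyP => i; rewrite coef0; exact: f0.
- move=> i; rewrite ltnS leq_eqVlt => /orP [/eqP ->|lt_in].
    rewrite /Q leqnn ltnn; split=> // /(_ 'X X_coef0); exact: nX.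
  have [PP nPP] := ltP i lt_in; rewrite /Q (ltnW lt_in) lt_in.
  split=> [f Pf j|PX]; first exact: PP.
  apply: nPP => d Pd; have idP := prime_ideal_ideal (qP _ lt_in).1.
  have := PX d%:P; move: Pd; rewrite -{1}(contraction_poly_in idP) => Pd.
  by move=> /(_ Pd 0%N); rewrite coefC.
move=> i; rewrite ltnS leq_eqVlt => /orP [/eqP ->|lt_in].
  rewrite /Q ltnn; apply/(quasi_star_prime_XE _ sstar); split.
  - exact: prime_ideal_coef0.
  - move=> Q0; have : [set f : {poly D} | P n f`_0] 'X by [].
    by rewrite Q0 => /eqP; rewrite polyX_eq0.
  - suff -> : contraction [set f : {poly D} | P n f`_0] = P n.
      exact: (qP n _).2.
    by apply/seteqP; split=> d; rewrite /contraction /= coefC.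
rewrite /Q lt_in; apply/(quasi_star_prime_XE _ sstar).
have [pPi nPi] := qP _ lt_in; have idPi := prime_ideal_ideal pPi.
split; [exact: prime_ideal_poly_in| |by rewrite contraction_poly_in].
move=> Pi0; case: (ltP i lt_in) => _; apply.
rewrite -[P i.+1](contraction_poly_in idPi) Pi0 contraction_set0 => _ ->.
by apply: ideal0; exact: prime_ideal_ideal (qP _ (ltnW lt_in)).1.
Qed.

Theorem theorem3p3 (D : idomainType)
    (star : set {fraction D} -> set {fraction D}) (n : nat) :
  semistar star ->
  PstarMD star ->
  semistar_dim (star_tilde star) n ->
  semistar_dim (star_X star) n.+1.
Proof.
move=> sstar pmd [ubn lubn].
(* The least upper bound is attained: for 0 by the trivial chain, and otherwise because its
   predecessor would be an upper bound too. *)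
have [P chainP] : exists P, quasi_star_prime_chain (star_tilde star) n P.
  apply: contrapT => nex; case: n ubn lubn nex => [|n] ubn lubn nex.
    by apply: nex; exists (fun=> [set 0]).
  suff /lubn : ubound [set m | exists P,
      quasi_star_prime_chain (star_tilde star) m P] n
    by rewrite Order.NatOrder.leEnat ltnn.
  move=> m exm; have := ubn _ exm; rewrite !Order.NatOrder.leEnat leq_eqVlt.
  by case/orP => [/eqP mE|//]; case: nex; rewrite -mE.
split=> [m [Q chainQ]|b]; last by apply; exact: star_X_chain_exists chainP.
apply: star_X_chain_le chainQ => // k R chainR.
by apply: ubn; exists R.
Qed.
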